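(* Let $A$ be a finite set, $n\ge3$, and let $\rho\subseteq A^n$ be preserved by a WNU, with pattern equal to the equivalence relation with classes $\{1,2\},\{3\},\dots,\{n\}$. Then $\rho$ is a key relation if and only if there exist $(a_1,\dots,a_n)\in A^n\setminus\rho$ and $b_1,\dots,b_n\in A$ with $b_i\neq a_i$ for all $i$ such that $$(\{a_1,b_1\}\times\dots\times\{a_n,b_n\})\setminus\{(a_1,a_2,a_3,\dots,a_n),(b_1,b_2,a_3,\dots,a_n)\}\subseteq\rho.$$
   Context: A unary vector-function is a tuple $\Psi=(\psi_1,\dots,\psi_n)$ of maps $\psi_i:A\to A$ acting coordinatewise; it preserves $\rho$ if $\Psi(\rho)\subseteq\rho$. $\rho\subseteq A^n$ is a key relation if there is $\beta\in A^n\setminus\rho$ (a key tuple) such that every $\alpha\in A^n\setminus\rho$ is mapped to $\beta$ by some unary vector-function preserving $\rho$. A WNU is an $m$-ary ($m\ge2$) operation $f$ on $A$ with $f(x,\dots,x)=x$ and $f(y,x,\dots,x)=f(x,y,x,\dots,x)=\dots=f(x,\dots,x,y)$; it preserves $\rho$ if applying it coordinatewise to any $m$ tuples of $\rho$ gives a tuple of $\rho$. The pattern of $\rho$: for $i\ne j$, $i\overset{\rho}{\sim}j$ iff there do NOT exist $c_1,\dots,c_n,d_i,d_j\in A$ with $(c_1,\dots,c_n)\notin\rho$ while the tuples obtained by replacing $c_i$ by $d_i$, replacing $c_j$ by $d_j$, and replacing both, all lie in $\rho$; and $i\overset{\rho}{\sim}i$ always. *)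

(* Defs.v *)
(* Tuples in A^n are n.-tuple A, coordinates indexed by 'I_n (0-based). *)
From mathcomp Require Import all_boot.
Set Implicit Arguments. Unset Strict Implicit. Unset Printing Implicit Defensive.

Section Defs.
Variable A : finType.

Definition relation (n : nat) := pred (n.-tuple A).

Definition uvf_apply n (Psi : 'I_n -> A -> A) (t : n.-tuple A) : n.-tuple A :=
  [tuple Psi i (tnth t i) | i < n].

Definition uvf_preserves n (Psi : 'I_n -> A -> A) (rho : relation n) : Prop :=
  forall t, rho t -> rho (uvf_apply Psi t).

Definition key_tuple n (rho : relation n) (beta : n.-tuple A) : Prop :=
  ~~ rho beta /\
  forall alpha : n.-tuple A, ~~ rho alpha ->
    exists Psi : 'I_n -> A -> A, uvf_preserves Psi rho /\ uvf_apply Psi alpha = beta.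

Definition key_relation n (rho : relation n) : Prop :=
  exists beta, key_tuple rho beta.

Definition is_wnu m (f : m.-tuple A -> A) : Prop :=
  2 <= m /\
  (forall x : A, f [tuple x | _ < m] = x) /\
  (forall (x y : A) (i j : 'I_m),
     f [tuple if k == i then y else x | k < m] =
     f [tuple if k == j then y else x | k < m]).

Definition op_preserves m n (f : m.-tuple A -> A) (rho : relation n) : Prop :=
  forall ts : 'I_m -> n.-tuple A, (forall k, rho (ts k)) ->
    rho [tuple f [tuple tnth (ts k) i | k < m] | i < n].

Definition preserved_by_wnu n (rho : relation n) : Prop :=
  exists m (f : m.-tuple A -> A), is_wnu f /\ op_preserves f rho.

Definition upd n (c : n.-tuple A) (i : 'I_n) (d : A) : n.-tuple A :=
  [tuple if k == i then d else tnth c k | k < n].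

Definition pattern n (rho : relation n) (i j : 'I_n) : Prop :=
  i = j \/
  ~ (exists (c : n.-tuple A) (di dj : A),
       ~~ rho c /\ rho (upd c i di) /\ rho (upd c j dj) /\
       rho (upd (upd c i di) j dj)).

End Defs.

(* Main.v *)
(** A rectangular slice in the first two coordinates splits into two sides, so
    a tuple outside [rho] is collapsed onto [a] by an explicit vector-function:
    this gives the direction from the box to the key relation, without the WNU.

    Conversely, fix a key tuple [beta]. A pair of unrelated coordinates yields,
    after moving the witness to [beta], a two-dimensional box at [beta]. Boxes on
    [{i} u S] and [{j} u S] are merged into a box on [{i, j} u S] by applying an
    operation [F] that fixes [beta] and behaves on [S] like a WNU: if [F] sends
    the relevant rows of [rho] to tuples of [rho], their images are the new box;
    otherwise those rows are plugged into [F] and the key property moves the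
    result back to [beta], which lowers the arity of [F]. When one free argument
    is left, exchanging it with a plugged one by the WNU identity gives the box.
    For the related pair [{1, 2}] the missing corners with a nonempty part in [S]
    come from rectangularity. *)
Require Import Defs.
From mathcomp Require Import all_boot.

Set Implicit Arguments.
Unset Strict Implicit.
Unset Printing Implicit Defensive.

(** * Tuples as coordinate functions, and rectangular pairs of coordinates *)

Section PointwiseTuples.
Variables (A : finType) (n : nat).
Implicit Types (u v z d : 'I_n -> A) (S T V : {set 'I_n}).

(** Membership is tested on coordinate functions, so that tuples can be compared pointwise by [=1]
    without functional extensionality. *)
Definition holds (rho : relation A n) u : bool := rho [tuple u k | k < n].

Lemma holds_ext (rho : relation A n) u v : u =1 v -> holds rho u = holds rho v.
Proof. by move=> uv; rewrite /holds (eq_mktuple _ uv). Qed.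

Lemma holds_eq (rho : relation A n) u v : holds rho u -> u =1 v -> holds rho v.
Proof. by move=> Ru uv; rewrite -(holds_ext rho uv). Qed.

Lemma holds_tnth (rho : relation A n) (t : n.-tuple A) : holds rho (tnth t) = rho t.
Proof. by congr rho; apply: eq_from_tnth => k; rewrite tnth_mktuple. Qed.

Definition place (i j : 'I_n) (x y : A) z : 'I_n -> A :=
  fun k => if k == i then x else if k == j then y else z k.

(** For [i != j] and fixed [z], the pairs of values at [i] and [j] allowed by [rho] form a bipartite
    graph; the condition says that its components are complete bipartite. *)
Definition rectangular (rho : relation A n) (i j : 'I_n) : Prop :=
  forall x x' y y' z,
    holds rho (place i j x y z) -> holds rho (place i j x' y z) ->
    holds rho (place i j x y' z) -> holds rho (place i j x' y' z).

Lemma upd_mktuple u (i : 'I_n) (x : A) :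
  upd [tuple u k | k < n] i x = [tuple if k == i then x else u k | k < n].
Proof. by apply: eq_from_tnth => k; rewrite !tnth_mktuple. Qed.

Lemma pattern_rectangular (rho : relation A n) i j :
  i != j -> pattern rho i j -> rectangular rho i j.
Proof.
move=> ij [ij'|noex] x x' y y' z Rxy Rx'y Rxy'; first by rewrite ij' eqxx in ij.
apply/negPn/negP => NR; apply: noex.
(* If the corner [(x', y')] were missing, it would be a witness against the pattern, with [x] and
   [y] as replacements. *)
exists [tuple place i j x' y' z k | k < n], x, y.
split=> //; rewrite !upd_mktuple; split; [|split].
- rewrite -[rho _]/(holds rho _) (@holds_ext _ _ (place i j x y' z)) //.
  by move=> k; rewrite /place; case: eqP.
- rewrite -[rho _]/(holds rho _) (@holds_ext _ _ (place i j x' y z)) //.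
  move=> k; rewrite /place; case: (k =P j) => [->|] //; by rewrite eq_sym (negPf ij).
- rewrite -[rho _]/(holds rho _) (@holds_ext _ _ (place i j x y z)) //.
  move=> k; rewrite /place; case: (k =P j) => [->|]; first by rewrite eq_sym (negPf ij).
  by case: eqP.
Qed.

(** * Boxes at a key tuple *)

Section KeyTuple.
Variables (rho : relation A n) (beta : 'I_n -> A).
Hypothesis key : forall alpha, ~~ holds rho alpha ->
  exists psi : 'I_n -> A -> A,
    (forall t, holds rho t -> holds rho (fun k => psi k (t k))) /\
    (forall k, psi k (alpha k) = beta k).

Notation R := (holds rho).

Definition sub T d : 'I_n -> A := fun k => if k \in T then d k else beta k.

(** A box with sides [{beta k, d k}] for [k] in [V] and the corner [beta] removed; a corner is
    encoded by the set [T] of coordinates at which it takes the value of [d]. *)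
Definition cube V d : Prop := forall T, T \subset V -> T != set0 -> R (sub T d).

Lemma sub0 d : sub set0 d =1 beta.
Proof. by move=> k; rewrite /sub in_set0. Qed.

(** * Merging two boxes that share the coordinates in [S] *)

Section Combine.
Variables (i j : 'I_n) (S : {set 'I_n}).
Hypotheses (iS : i \notin S) (jS : j \notin S).
Notation vec := (place i j).
Notation bi := (beta i).
Notation bj := (beta j).

(** [Rx] and [Rz] give a box on [i] and [S], [Ry] and [Rw] one on [j] and [S]. The primed values
    give a box on [i] and [j]; if [rect] holds, rectangularity replaces its far corner. *)
Variables (rect : bool) (x y x' y' : A) (z w : 'I_n -> A).
Hypothesis Rx : forall T, T \subset S -> R (vec x bj (sub T z)).
Hypothesis Rz : forall T, T \subset S -> T != set0 -> R (sub T z).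
Hypothesis Ry : forall T, T \subset S -> R (vec bi y (sub T w)).
Hypothesis Rw : forall T, T \subset S -> T != set0 -> R (sub T w).
Hypothesis Rx' : R (vec x' bj beta).
Hypothesis Ry' : R (vec bi y' beta).
Hypothesis Rx'y' : if rect then rectangular rho i j else R (vec x' y' beta).

(** The target box on [i], [j] and [S]. If [rect] holds, the corner that moves exactly [i] and [j]
    is not claimed. *)
Definition combined b1 b2 v : Prop :=
  [/\ R (vec b1 bj beta), R (vec bi b2 beta), ~~ rect -> R (vec b1 b2 beta) &
   forall T, T \subset S -> T != set0 ->
     [/\ R (vec bi bj (sub T v)), R (vec b1 bj (sub T v)),
         R (vec bi b2 (sub T v)) & R (vec b1 b2 (sub T v))]].

Lemma notin_sub (k : 'I_n) T : T \subset S -> k \notin S -> k \notin T.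
Proof. by move=> TS; apply: contra => /(subsetP TS). Qed.

Lemma place_beta T d : T \subset S -> (vec bi bj (sub T d)) =1 sub T d.
Proof.
move=> TS k; rewrite /place /sub; case: eqP => [->|_].
  by rewrite (negPf (notin_sub TS iS)).
by case: eqP => [->|_] //; rewrite (negPf (notin_sub TS jS)).
Qed.

Lemma place_S a b k : k \in S -> vec a b beta k = beta k.
Proof.
by rewrite /place => kS; case: eqP kS => [->|_]; rewrite ?(negPf iS) //;
  case: eqP => [->|_]; rewrite ?(negPf jS).
Qed.

(* Writing [t] on [T] into the row [r0] has the same effect as writing it into
   the free argument, by symmetry of [G]. *)
Lemma combine_binary (G : 'I_n -> A -> A -> A) (r0 t : 'I_n -> A) :
    (forall u v, R u -> R v -> R (fun k => G k (u k) (v k))) ->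
    (forall k a, k \in S -> G k a (beta k) = G k (beta k) a) ->
    (forall k, G k (r0 k) (beta k) = beta k) ->
    (forall k, k \in S -> r0 k = beta k) ->
    (forall T, T \subset S -> R (fun k => if k \in T then t k else r0 k)) ->
    (forall T, T \subset S -> T != set0 -> R (sub T t)) ->
  exists b1 b2 v, combined b1 b2 v.
Proof.
move=> Gpres Gsym Gfix r0S Rr Rt.
(* The box on [i] and [j] enters through the free argument of [G], which fixes [beta] once [r0] is
   plugged in; the values of [t] enter through the plugged row. *)
pose b1 := G i (r0 i) x'; pose b2 := G j (r0 j) y'.
pose v k := G k (t k) (beta k).
have RT a b T : T \subset S -> R (vec a b beta) ->
    R (vec (G i (r0 i) a) (G j (r0 j) b) (sub T v)).
  move=> TS Rab; apply: (holds_eq (Gpres _ _ (Rr T TS) Rab)) => k.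
  rewrite /place; case: eqP => [->|_]; first by rewrite (negPf (notin_sub TS iS)).
  case: eqP => [->|_]; first by rewrite (negPf (notin_sub TS jS)).
  by rewrite /sub /v; case: ifP.
have vec0 a b : vec a b (sub set0 v) =1 vec a b beta.
  by move=> k; rewrite /place sub0.
have RT1 T : T \subset S -> R (vec b1 bj (sub T v)).
  by move=> TS; rewrite -[bj](Gfix j); apply: RT.
have RT2 T : T \subset S -> R (vec bi b2 (sub T v)).
  by move=> TS; rewrite -[bi](Gfix i); apply: RT.
have RT0 T : T \subset S -> T != set0 -> R (vec bi bj (sub T v)).
  move=> TS T0; have R0 := Rr set0 (sub0set _).
  apply: (holds_eq (Gpres _ _ R0 (Rt T TS T0))) => k.
  rewrite place_beta // in_set0 /sub /v; case: ifP => // kT.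
  by have kS := subsetP TS k kT; rewrite r0S // Gsym.
exists b1, b2, v; split.
- by apply: holds_eq (vec0 _ _); apply: RT1; apply: sub0set.
- by apply: holds_eq (vec0 _ _); apply: RT2; apply: sub0set.
- move=> Nrect; move: Rx'y'; rewrite (negPf Nrect) => Rp.
  by apply: holds_eq (vec0 _ _); apply: RT => //; apply: sub0set.
- move=> T TS T0; split; [exact: RT0|exact: RT1|exact: RT2|].
  case: rect Rx'y' => [Rrect|Rp]; last exact: RT.
  by apply: (Rrect bi _ bj); [exact: RT0|exact: RT1|exact: RT2].
Qed.

(** These are the properties that survive plugging a row and composing with [psi]: the fixed value
    is required only at [beta], and symmetry only on [S], where the plugged rows agree with [beta].
    Arguments form a list, so that plugging is consing. *)
Record wnu_at_beta (m : nat) (F : 'I_n -> seq A -> A) : Prop := WnuAtBeta {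
  wab_pres : forall rows : seq ('I_n -> A), size rows = m -> all R rows ->
    R (fun k => F k [seq r k | r : 'I_n -> A <- rows]);
  wab_fix : forall k, F k (nseq m (beta k)) = beta k;
  wab_sym : forall k a p q p' q', k \in S -> p + q.+1 = m -> p' + q'.+1 = m ->
    F k (nseq p (beta k) ++ a :: nseq q (beta k)) =
    F k (nseq p' (beta k) ++ a :: nseq q' (beta k)) }.

Lemma sub0vec a b d : vec a b (sub set0 d) =1 vec a b beta.
Proof. by move=> k; rewrite /place sub0. Qed.

Lemma Rx0 : R (vec x bj beta).
Proof. exact: holds_eq (Rx (sub0set _)) (sub0vec _ _ _). Qed.

Lemma Ry0 : R (vec bi y beta).
Proof. exact: holds_eq (Ry (sub0set _)) (sub0vec _ _ _). Qed.

Lemma Rx_upd T : T \subset S -> R (fun k => if k \in T then z k else vec x bj beta k).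
Proof.
move=> TS; apply: (holds_eq (Rx TS)) => k; rewrite /place /sub.
case: eqP => [->|_]; first by rewrite (negPf (notin_sub TS iS)).
by case: eqP => [->|_]; first by rewrite (negPf (notin_sub TS jS)).
Qed.

Lemma Ry_upd T : T \subset S -> R (fun k => if k \in T then w k else vec bi y beta k).
Proof.
move=> TS; apply: (holds_eq (Ry TS)) => k; rewrite /place /sub.
case: eqP => [->|_]; first by rewrite (negPf (notin_sub TS iS)).
by case: eqP => [->|_]; first by rewrite (negPf (notin_sub TS jS)).
Qed.

(** The induction is strong because the last failing case plugs two rows at once. In each failing
    case [psi] sends the tuple outside [rho] back to [beta], so the operation of smaller arity again
    fixes [beta]. *)
Lemma combine_wnu m F : wnu_at_beta m.+2 F -> exists b1 b2 v, combined b1 b2 v.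
Proof.
elim/ltn_ind: m F => m IH F [Fpres Ffix Fsym].
(* [X] and [Y] are the only coordinates moved when one argument [beta] of [F] is replaced: the first
   by the row with [x], respectively the second by the row with [y]. *)
pose X := F i (x :: nseq m.+1 bi); pose Y := F j (bj :: y :: nseq m bj).
have [RX|NX] := boolP (R (vec X bj beta)); last first.
  have [psi [psiR psiE]] := key NX.
  have Hfix k : psi k (F k (vec x bj beta k :: nseq m.+1 (beta k))) = beta k.
    rewrite -[RHS]psiE; congr (psi k _); rewrite /place.
    case: eqP => [->|_] //; case: eqP => [->|_]; exact: Ffix.
  case: m => [|m] in IH F Fpres Ffix Fsym X Y NX psiE Hfix *.
    apply: (@combine_binary (fun k a b => psi k (F k [:: a; b])) (vec x bj beta) z) => //.
    - by move=> u v Ru Rv; apply/psiR/(Fpres [:: u; v]) => //=; rewrite Ru Rv.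
    - by move=> k a kS; congr (psi k _); apply: (Fsym k a 0 1 1 0).
    - by move=> k; apply: place_S.
    - exact: Rx_upd.
  apply: (IH m _ (fun k s => psi k (F k (vec x bj beta k :: s)))) => //.
  split=> //.
  - move=> rows sz Rrows; apply/psiR/(Fpres (vec x bj beta :: rows)) => /=.
      by rewrite sz.
    by rewrite Rx0.
  - move=> k a p q p' q' kS e e'; congr (psi k _); rewrite place_S //.
    by apply: (Fsym k a p.+1 q p'.+1 q') => //; rewrite addSn ?e ?e'.
have [RY|NY] := boolP (R (vec bi Y beta)); last first.
  have [psi [psiR psiE]] := key NY.
  have Hfix k : psi k (F k (beta k :: vec bi y beta k :: nseq m (beta k))) = beta k.
    rewrite -[RHS]psiE; congr (psi k _); rewrite /place.
    case: eqP => [->|_]; first exact: Ffix.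
    case: eqP => [->|_] //; exact: Ffix.
  case: m => [|m] in IH F Fpres Ffix Fsym X Y RX NY psiE Hfix *.
    apply: (@combine_binary (fun k a b => psi k (F k [:: b; a])) (vec bi y beta) w) => //.
    - by move=> u v Ru Rv; apply/psiR/(Fpres [:: v; u]) => //=; rewrite Ru Rv.
    - by move=> k a kS; congr (psi k _); apply: (Fsym k a 1 0 0 1).
    - by move=> k; apply: place_S.
    - exact: Ry_upd.
  (* The plugged row stays in second place; the value [beta k] on the empty list is never reached,
     since the new arity is [m.+2]. *)
  apply: (IH m _ (fun k s =>
    if s is a :: s' then psi k (F k (a :: vec bi y beta k :: s')) else beta k)) => //.
  split=> //.
  - move=> [|r rows] //= [sz] /andP[Rr Rrows].
    apply/psiR/(Fpres (r :: vec bi y beta :: rows)) => /=; first by rewrite sz.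
    by rewrite Rr Ry0.
  - move=> k a p q p' q' kS.
    have shift p0 q0 : p0 + q0.+1 = m.+2 ->
      (if nseq p0 (beta k) ++ a :: nseq q0 (beta k) is c :: s' then
         psi k (F k (c :: vec bi y beta k :: s')) else beta k) =
      psi k (F k (a :: nseq m.+2 (beta k))).
      rewrite place_S //; case: p0 => [|p0] /= e; congr (psi k _).
        by case: e => ->.
      by apply: (Fsym k a p0.+2 q0 0 m.+2) => //; rewrite addSn e.
    by move=> e e'; rewrite !shift.
have [RXY|/norP[Nrect NXY]] := boolP (rect || R (vec X Y beta)); last first.
  have [psi [psiR psiE]] := key NXY.
  have Hfix k :
      psi k (F k (vec x bj beta k :: vec bi y beta k :: nseq m (beta k))) = beta k.
    rewrite -[RHS]psiE; congr (psi k _); rewrite /place.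
    case: eqP => [->|_] //; case: eqP => [->|_] //; exact: Ffix.
  case: m => [|[|m]] in IH F Fpres Ffix Fsym X Y RX RY NXY psiE Hfix *.
  (* In arity two both arguments are rows of [rho], so their image, which is [vec X Y beta], cannot
     lie outside [rho]. *)
  - case/negP: NXY.
    have := Fpres [:: vec x bj beta; vec bi y beta] erefl.
    rewrite /= Rx0 Ry0 => /(_ isT) RF; apply: (holds_eq RF) => k.
    rewrite /place; case: eqP => [->|_] //; case: eqP => [->|_] //; exact: Ffix.
  - apply: (@combine_binary (fun k a b => psi k (F k [:: a; vec bi y beta k; b]))
              (vec x bj beta) z) => //.
    + move=> u v Ru Rv; apply/psiR/(Fpres [:: u; vec bi y beta; v]) => //=.
      by rewrite Ru Rv Ry0.
    + move=> k a kS; congr (psi k _); rewrite place_S //.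
      exact: (Fsym k a 0 2 2 0).
    + by move=> k; apply: place_S.
    + exact: Rx_upd.
  apply: (IH m _ (fun k s => psi k (F k (vec x bj beta k :: vec bi y beta k :: s)))) => //.
  split=> //.
  - move=> rows sz Rrows.
    apply/psiR/(Fpres (vec x bj beta :: vec bi y beta :: rows)) => /=.
      by rewrite sz.
    by rewrite Rx0 Ry0.
  - move=> k a p q p' q' kS e e'; congr (psi k _); rewrite !place_S //.
    by apply: (Fsym k a p.+2 q p'.+2 q') => //; rewrite !addSn ?e ?e'.
exists X, Y, (fun k => F k (z k :: nseq m.+1 (w k))).
split=> //; first by move=> Nrect; rewrite (negPf Nrect) in RXY.
move=> T TS T0.
(* Taking [u] in [{bi, x}] and [v] in [{bj, y}] yields all four corners over [T]; the repeated row
   [sub T w] is in [rho] because [T] is nonempty. *)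
have Rrows (u v : A) : R (vec u bj (sub T z)) -> R (vec bi v (sub T w)) ->
    R (vec (F i (u :: nseq m.+1 bi)) (F j (bj :: v :: nseq m bj))
        (sub T (fun k => F k (z k :: nseq m.+1 (w k))))).
  move=> Ru Rv.
  have := Fpres [:: vec u bj (sub T z), vec bi v (sub T w) & nseq m (sub T w)].
  rewrite /= size_nseq Ru Rv all_nseq Rw // orbT => /(_ erefl isT) RF.
  apply: (holds_eq RF) => k; rewrite map_nseq /place.
  case: eqP => [->|_]; first by rewrite /sub (negPf (notin_sub TS iS)).
  case: eqP => [->|_]; first by rewrite /sub (negPf (notin_sub TS jS)).
  by rewrite /sub; case: ifP => // _; apply: Ffix.
have Rz0 : R (vec bi bj (sub T z)) by rewrite (holds_ext _ (place_beta _ TS)) Rz.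
have Rw0 : R (vec bi bj (sub T w)) by rewrite (holds_ext _ (place_beta _ TS)) Rw.
have Fi : F i (bi :: nseq m.+1 bi) = bi by apply: Ffix.
have Fj : F j (bj :: bj :: nseq m bj) = bj by apply: Ffix.
split; last by apply: Rrows; [exact: Rx|exact: Ry].
- by have := Rrows _ _ Rz0 Rw0; rewrite Fi Fj.
- by have := Rrows _ _ (Rx TS) Rw0; rewrite Fj.
- by have := Rrows _ _ Rz0 (Ry TS); rewrite Fi.
Qed.

End Combine.

(** * Growing cubes coordinate by coordinate *)

Variables (m : nat) (F : 'I_n -> seq A -> A).
Hypothesis Fwnu : forall S, wnu_at_beta S m.+2 F.

(** Both kinds of pairs are served: with [rect] false, [g] supplies the corner [[set i; j]]; with
    [rect] true, that corner is left out. *)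
Lemma combine_cubes (rect : bool) i j S d e g :
    i != j -> i \notin S -> j \notin S ->
    cube (i |: S) d -> cube (j |: S) e ->
    R (sub [set i] g) -> R (sub [set j] g) ->
    (if rect then rectangular rho i j else R (sub [set i; j] g)) ->
  exists b, forall T, T \subset i |: (j |: S) -> T != set0 ->
    ~~ (rect && (T == [set i; j])) -> R (sub T b).
Proof.
move=> ij iS jS Cd Ce Rgi Rgj Rgij.
have ji : (j == i) = false by rewrite eq_sym (negPf ij).
have notT k T : T \subset S -> k \notin S -> (k \in T) = false.
  by move=> TS; apply: contraNF => /(subsetP TS).
have Rd T : T \subset S -> R (place i j (d i) (beta j) (sub T d)).
  move=> TS; apply: (@holds_eq _ (sub (i |: T) d)).
    by apply: Cd; [rewrite setUS|apply/set0Pn; exists i; rewrite !inE eqxx].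
  move=> k; rewrite /sub /place !inE; case: eqP => [->|_] //=.
  by case: eqP => [->|_] //; rewrite notT.
have Re T : T \subset S -> R (place i j (beta i) (e j) (sub T e)).
  move=> TS; apply: (@holds_eq _ (sub (j |: T) e)).
    by apply: Ce; [rewrite setUS|apply/set0Pn; exists j; rewrite !inE eqxx].
  move=> k; rewrite /sub /place !inE; case: (k =P i) => [->|_] /=.
    by rewrite (negPf ij) notT.
  by case: eqP => [->|_].
have Rd0 T : T \subset S -> T != set0 -> R (sub T d).
  by move=> TS; apply: Cd; apply: subset_trans TS (subsetUr _ _).
have Re0 T : T \subset S -> T != set0 -> R (sub T e).
  by move=> TS; apply: Ce; apply: subset_trans TS (subsetUr _ _).
have Rg1 : R (place i j (g i) (beta j) beta).
  apply: (holds_eq Rgi) => k; rewrite /sub /place !inE.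
  by case: eqP => [->|_] //; case: eqP => [->|_].
have Rg2 : R (place i j (beta i) (g j) beta).
  apply: (holds_eq Rgj) => k; rewrite /sub /place !inE.
  by case: (k =P i) => [->|_]; [rewrite (negPf ij)|case: eqP => [->|_]].
have Rg12 : if rect then rectangular rho i j else R (place i j (g i) (g j) beta).
  case: rect Rgij => // Rgij; apply: (holds_eq Rgij) => k; rewrite /sub /place !inE.
  by case: eqP => [->|_] //; case: eqP => [->|_].
have [b1 [b2 [v [C1 C2 C12 CT]]]] :=
  combine_wnu iS jS Rd Rd0 Re Re0 Rg1 Rg2 Rg12 (Fwnu S).
exists (place i j b1 b2 v) => T TV T0 NT.
pose T' := T :\ i :\ j.
have T'S : T' \subset S.
  apply/subsetP => k; rewrite !inE => /and3P[kj ki /(subsetP TV)].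
  by rewrite !inE (negPf ki) (negPf kj).
have subE : place i j (if i \in T then b1 else beta i)
    (if j \in T then b2 else beta j) (sub T' v) =1 sub T (place i j b1 b2 v).
  move=> k; rewrite /place /sub !inE; case: (k =P i) => [->|_] //.
  by case: (k =P j) => [->|_].
apply: holds_eq subE.
have [T'0|T'N] := eqVneq T' set0; last by case: (CT T' T'S T'N); do 2!case: ifP.
have vec0 a b : place i j a b (sub T' v) =1 place i j a b beta.
  by move=> k; rewrite /place T'0 sub0.
rewrite (holds_ext _ (vec0 _ _)).
have TE k : k \in T -> k = i \/ k = j.
  move=> kT; have := in_set0 k; rewrite -T'0 !inE kT andbT.
  by case: eqP => [|_]; [right|case: eqP => [|_] //; left].
case: ifP => iT; case: ifP => jT //.
  apply: C12; apply: contraNN NT => ->; apply/eqP/setP => k; rewrite !inE.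
  apply/idP/orP => [/TE[]->|[]/eqP->] //; rewrite eqxx; [left|right] => //.
by case/set0Pn: T0 => k kT; case: (TE k kT) => E; rewrite E ?iT ?jT in kT.
Qed.

(** Induction on the size of [V]: deleting [j] or [i] leaves two smaller cubes, which merge along
    the box of the pair. *)
Lemma cube_of_pairs V :
    (forall i, exists g, R (sub [set i] g)) ->
    (forall i j, i \in V -> j \in V -> i != j -> exists g,
       [/\ R (sub [set i] g), R (sub [set j] g) & R (sub [set i; j] g)]) ->
  exists d, cube V d.
Proof.
move=> single; elim/ltn_ind: {V}#|V| {-2}V (erefl #|V|) => N IH V VN pairs.
have [->|/set0Pn[i iV]] := eqVneq V set0.
  by exists beta => T; rewrite subset0 => ->.
have [V1|/set0Pn[j]] := eqVneq (V :\ i) set0.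
  have [g Rg] := single i; exists g => T TV T0.
  suff -> : T = [set i] by [].
  have Vi : V = [set i] by rewrite -(setD1K iV) V1 setU0.
  by move: TV T0; rewrite Vi subset1 => /orP[/eqP//|->].
rewrite !inE => /andP[ji jV]; have ij : i != j by rewrite eq_sym.
pose S := V :\ i :\ j.
have VE : V = i |: (j |: S) by rewrite !setD1K // !inE ji.
have iS : i \notin S by rewrite !inE eqxx andbF.
have jS : j \notin S by rewrite !inE eqxx.
have smaller k : (k == i) || (k == j) -> k \notin S -> exists d, cube (k |: S) d.
  move=> kij kS.
  have kV : k |: S \subset V.
    by rewrite VE subUset sub1set !in_setU1 orbA kij setUA subsetUr.
  apply: (IH #|k |: S|) => //.
    by rewrite -VN VE !cardsU1 in_setU1 negb_or iS jS kS ij.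
  by move=> a b aV bV; apply: pairs; apply: (subsetP kV).
have [d Cd] : exists d, cube (i |: S) d by apply: smaller; rewrite ?eqxx.
have [e Ce] : exists d, cube (j |: S) d by apply: smaller; rewrite ?eqxx ?orbT.
have [g [Rgi Rgj Rgij]] := pairs i j iV jV ij.
have [b Cb] := @combine_cubes false i j S d e g ij iS jS Cd Ce Rgi Rgj Rgij.
by exists b => T; rewrite VE => TV T0; apply: Cb.
Qed.

End KeyTuple.

(** * The WNU as an operation on lists *)

Definition seq_op m (f : m.-tuple A -> A) u (k : 'I_n) (s : seq A) : A :=
  f [tuple nth (u k) s l | l < m].

(** The base point [u k] is also the default of [nth], so reading past the end of a list agrees with
    its padding by [u k]. *)
Lemma wnu_seq_op (rho : relation A n) m (f : m.-tuple A -> A) u S :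
  is_wnu f -> op_preserves f rho -> wnu_at_beta rho u S m (seq_op f u).
Proof.
move=> [_ [idem sym]] pres; split.
- move=> rows sz /(all_nthP u) Rrows.
  pose ts (l : 'I_m) := [tuple nth u rows l k | k < n].
  have Rts l : rho (ts l) by apply: Rrows; rewrite sz.
  have := pres ts Rts; rewrite -holds_tnth => Rf; apply: (holds_eq Rf) => k.
  rewrite tnth_mktuple; congr f; apply: eq_from_tnth => l.
  by rewrite !tnth_mktuple (nth_map u) ?sz.
- move=> k; rewrite /seq_op -[RHS]idem; congr f; apply: eq_from_tnth => l.
  by rewrite !tnth_mktuple nth_nseq if_same.
- move=> k a p q p' q' _ e e'.
  have nthE p0 q0 (lt : p0 < m) : seq_op f u k (nseq p0 (u k) ++ a :: nseq q0 (u k)) =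
      f [tuple if l == Ordinal lt then a else u k | l < m].
    congr f; apply: eq_from_tnth => l; rewrite !tnth_mktuple nth_cat size_nseq.
    rewrite -val_eqE /=; case: ltngtP => [lp|pl|->].
    + by rewrite nth_nseq lp.
    + by rewrite -(subnSK pl) /= nth_nseq if_same.
    + by rewrite subnn.
  have lt : p < m by rewrite -e addnS ltnS leq_addr.
  have lt' : p' < m by rewrite -e' addnS ltnS leq_addr.
  by rewrite (nthE _ _ lt) (nthE _ _ lt').
Qed.

End PointwiseTuples.

(** * Two-dimensional boxes from unrelated pairs *)

Lemma pattern_pair (A : finType) n (rho : relation A n) (beta : 'I_n -> A) i j :
    (forall alpha, ~~ holds rho alpha ->
      exists psi : 'I_n -> A -> A,
        (forall t, holds rho t -> holds rho (fun k => psi k (t k))) /\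
        (forall k, psi k (alpha k) = beta k)) ->
    i != j -> ~ pattern rho i j ->
  exists g, [/\ holds rho (sub beta [set i] g), holds rho (sub beta [set j] g)
              & holds rho (sub beta [set i; j] g)].
Proof.
move=> key ij Npat.
have ji : (j == i) = false by rewrite eq_sym (negPf ij).
(* Finiteness of [A] makes the existence of a witness decidable, so the double negation can be
   removed. *)
have /existsP[c /existsP[di /existsP[dj /and4P[Nc Ri Rj Rij]]]] :
    [exists c, exists di, exists dj, [&& ~~ rho c, rho (upd c i di),
      rho (upd c j dj) & rho (upd (upd c i di) j dj)]].
  apply: contraT => NE; exfalso; apply: Npat; right=> -[c [di [dj [Nc [Ri [Rj Rij]]]]]].
  case/negP: NE; apply/existsP; exists c; apply/existsP; exists di.
  by apply/existsP; exists dj; apply/and4P.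
have [psi [psiR psiE]] : exists psi : 'I_n -> A -> A,
    (forall t, holds rho t -> holds rho (fun k => psi k (t k))) /\
    (forall k, psi k (tnth c k) = beta k) by apply: key; rewrite holds_tnth.
exists (place i j (psi i di) (psi j dj) beta).
split.
- move: Ri; rewrite -holds_tnth => /psiR Ri; apply: (holds_eq Ri) => k.
  by rewrite /sub /place tnth_mktuple inE; case: eqP => [->|_].
- move: Rj; rewrite -holds_tnth => /psiR Rj; apply: (holds_eq Rj) => k.
  by rewrite /sub /place tnth_mktuple inE; case: (k =P j) => [->|_]; rewrite ?ji.
- move: Rij; rewrite -holds_tnth => /psiR Rij; apply: (holds_eq Rij) => k.
  rewrite /sub /place !tnth_mktuple !inE; case: (k =P i) => [->|_] /=.
    by rewrite (negPf ij).
  by case: (k =P j) => [->|_].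
Qed.

(** * From the box to the key tuple *)

Lemma box_key_tuple (A : finType) n (rho : relation A n) (i j : 'I_n) (a b : n.-tuple A) :
    i != j -> rectangular rho i j -> ~~ rho a ->
    (forall k, tnth b k != tnth a k) ->
    (forall x : n.-tuple A, (forall k, tnth x k = tnth a k \/ tnth x k = tnth b k) ->
       x <> a ->
       x <> [tuple if (k == i) || (k == j) then tnth b k else tnth a k | k < n] ->
       rho x) ->
  key_tuple rho a.
Proof.
move=> ij rect Na ba box; split=> // alpha Nalpha.
have ji : (j == i) = false by rewrite eq_sym (negPf ij).
pose sigma x y := holds rho (place i j x y (tnth alpha)).
(* [nbr] selects the values at [i] in the component of [alpha i]: that value itself and those
   sharing a neighbour with it. *)
pose nbr x := (x == tnth alpha i) || [exists y, sigma x y && sigma (tnth alpha i) y].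
have sigma_alpha x y : sigma x y -> nbr x = sigma (tnth alpha i) y.
  move=> sxy; apply/orP/idP => [[/eqP<- //|/existsP[y' /andP[sxy' say']]]|say].
    by apply: (rect x _ y').
  by right; apply/existsP; exists y; rewrite sxy.
(* An edge inside the component of [alpha i] goes to [(a i, b j)] and any other edge to
   [(b i, a j)], so neither excluded corner is hit. The non-adjacent pair [(alpha i, alpha j)] goes
   to [(a i, a j)]. *)
pose psi k x := if k == i then if nbr x then tnth a i else tnth b i
  else if k == j then if sigma (tnth alpha i) x then tnth b j else tnth a j
  else if x == tnth alpha k then tnth a k else tnth b k.
have Nsigma : sigma (tnth alpha i) (tnth alpha j) = false.
  apply: contraNF Nalpha; rewrite -holds_tnth => Rs; apply: (holds_eq Rs) => k.
  by rewrite /place; case: eqP => [->|_] //; case: eqP => [->|].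
exists psi; split; last first.
  apply: eq_from_tnth => k; rewrite tnth_mktuple /psi.
  case: eqP => [->|_]; first by rewrite /nbr eqxx.
  by case: eqP => [->|_]; rewrite ?Nsigma ?eqxx.
move=> t Rt.
have outcome : [\/ exists2 k, ~~ ((k == i) || (k == j)) & psi k (tnth t k) = tnth b k,
    psi i (tnth t i) = tnth a i /\ psi j (tnth t j) = tnth b j |
    psi i (tnth t i) = tnth b i /\ psi j (tnth t j) = tnth a j].
  have [/existsP[k /andP[kij tk]]|/existsPn talpha] :=
      boolP [exists k, ~~ ((k == i) || (k == j)) && (tnth t k != tnth alpha k)].
    constructor 1; exists k => //; rewrite /psi (negPf tk).
    by case/norP: kij => /negPf-> /negPf->.
  have st : sigma (tnth t i) (tnth t j).
    move: Rt; rewrite -holds_tnth => Rt; apply: (holds_eq Rt) => k; rewrite /place.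
    case: (k =P i) (talpha k) => [->|_] //=; case: (k =P j) => [->|_] //=.
    by rewrite negbK => /eqP.
  rewrite /psi !eqxx ji (sigma_alpha _ _ st).
  by case: ifP => _; [constructor 2|constructor 3].
apply: box => [k||].
- rewrite tnth_mktuple /psi; case: eqP => [->|_]; first by case: ifP; auto.
  by case: eqP => [->|_]; case: ifP; auto.
- move=> E; have {}E k : psi k (tnth t k) = tnth a k by rewrite -E tnth_mktuple.
  by case: outcome => [[k _]|[_]|[]]; rewrite E => /esym/eqP; rewrite (negPf (ba _)).
- move=> /(congr1 (fun s => tnth s _)) E.
  have {}E k : psi k (tnth t k) = if (k == i) || (k == j) then tnth b k else tnth a k.
    by have := E k; rewrite !tnth_mktuple.
  case: outcome => [[k /negPf kij]|[+ _]|[_ +]]; rewrite E ?kij ?eqxx ?orbT => /eqP.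
  + by rewrite eq_sym (negPf (ba _)).
  + by rewrite (negPf (ba _)).
  + by rewrite (negPf (ba _)).
Qed.

(* Coordinates are 0-based: the paper's class {1,2} is {0,1} here. *)
Theorem mainTheorem9 (A : finType) (n : nat) (hn : 3 <= n) (rho : relation A n) :
  preserved_by_wnu rho ->
  (forall i j : 'I_n, pattern rho i j <-> (i = j \/ (val i < 2 /\ val j < 2))) ->
  (key_relation rho <->
   exists (a b : n.-tuple A),
     ~~ rho a /\
     (forall i, tnth b i != tnth a i) /\
     (forall x : n.-tuple A,
        (forall i, tnth x i = tnth a i \/ tnth x i = tnth b i) ->
        x <> a ->
        x <> [tuple if val i < 2 then tnth b i else tnth a i | i < n] ->
        rho x)).
Proof.
move=> [m [f [fwnu fpres]]] pat.
pose i0 : 'I_n := Ordinal (ltnW (ltnW hn)); pose i1 : 'I_n := Ordinal (ltnW hn).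
pose i2 : 'I_n := Ordinal hn.
have i01 : i0 != i1 by [].
have lt2 (k : 'I_n) : (val k < 2) = (k == i0) || (k == i1).
  by rewrite -!val_eqE /=; case: (val k) => [|[|]].
have rect : rectangular rho i0 i1.
  by apply: pattern_rectangular => //; apply/pat; right.
split; last first.
  move=> [a [b [Na [ba box]]]]; exists a.
  apply: (box_key_tuple i01 rect Na ba) => x xab xa xflip; apply: box => // E.
  by apply: xflip; rewrite E; apply: eq_mktuple => k; rewrite lt2.
move=> [a [Na keya]].
pose beta := tnth a.
have Nbeta : ~~ holds rho beta by rewrite holds_tnth.
have key alpha : ~~ holds rho alpha -> exists psi : 'I_n -> A -> A,
    (forall t, holds rho t -> holds rho (fun k => psi k (t k))) /\
    (forall k, psi k (alpha k) = beta k).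
  move=> /keya[psi [psiR psiE]]; exists psi; split=> [t Rt|k].
    move/psiR: Rt; rewrite -holds_tnth => Rt; apply: (holds_eq Rt) => k.
    by rewrite !tnth_mktuple.
  by rewrite /beta -psiE !tnth_mktuple.
have pairs i j : i != j -> ~~ ((val i < 2) && (val j < 2)) -> exists g,
    [/\ holds rho (sub beta [set i] g), holds rho (sub beta [set j] g)
      & holds rho (sub beta [set i; j] g)].
  move=> ij nij; apply: pattern_pair => //; case/pat => [E|[li lj]].
    by rewrite E eqxx in ij.
  by rewrite li lj in nij.
(* Every coordinate has an unrelated partner: [i2] serves all the others, and [i0] serves [i2]. *)
have single i : exists g, holds rho (sub beta [set i] g).
  have [->|ni2] := eqVneq i i2.
    by have [//|//|g [Rg _ _]] := pairs i2 i0; exists g.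
  by have [//||g [Rg _ _]] := pairs i i2; [rewrite andbF|exists g].
case: m => [|[|m]] in f fwnu fpres *; [by case: fwnu|by case: fwnu|].
have Fwnu S := wnu_seq_op beta S fwnu fpres.
pose S := ~: [set i0; i1].
have inS k : (k \in S) = ~~ (val k < 2) by rewrite !inE lt2.
(* Adding only one coordinate to [S] never brings the related pair together. *)
have cubeS i : exists d, cube rho beta (i |: S) d.
  apply: (cube_of_pairs key Fwnu) => // k l.
  rewrite !in_setU1 !inS => kS lS kl; apply: pairs => //.
  apply/negP => /andP[k2 l2]; move: kS lS kl; rewrite k2 l2 !orbF.
  by move=> /eqP-> /eqP->; rewrite eqxx.
have [d Cd] := cubeS i0; have [e Ce] := cubeS i1.
have [g0 Rg0] := single i0; have [g1 Rg1] := single i1.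
pose g := place i0 i1 (g0 i0) (g1 i1) beta.
have Rgi : holds rho (sub beta [set i0] g).
  apply: (holds_eq Rg0) => k; rewrite /sub inE /g /place.
  by case: eqP => [->|].
have Rgj : holds rho (sub beta [set i1] g).
  apply: (holds_eq Rg1) => k; rewrite /sub inE /g /place.
  by case: (k =P i1) => [->|].
have i0S : i0 \notin S by rewrite inS.
have i1S : i1 \notin S by rewrite inS.
have [b Cb] :=
  @combine_cubes _ _ _ _ key _ _ Fwnu true i0 i1 S d e g i01 i0S i1S Cd Ce Rgi Rgj rect.
have {}Cb T : T != set0 -> T != [set i0; i1] -> holds rho (sub beta T b).
  move=> T0 T01; apply: Cb => //; apply/subsetP => k _.
  by rewrite !in_setU1 inS lt2 orbA orbN.
exists a, [tuple b k | k < n]; split=> //; split=> [k|x xab xa xflip].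
  (* If [b k] equalled [a k], the corner moved only at [k] would be [beta] itself, which is outside
     [rho]. *)
  rewrite tnth_mktuple; apply: contraNneq Nbeta => bk.
  have Rk : holds rho (sub beta [set k] b).
    apply: Cb; first by apply/set0Pn; exists k; rewrite inE.
    by apply/eqP => /(congr1 (fun T : {set _} => #|T|)); rewrite cards1 cards2 i01.
  apply: (holds_eq Rk) => l; rewrite /sub inE; by case: eqP => [->|].
pose T := [set k | tnth x k != tnth a k].
have subE : sub beta T b =1 tnth x.
  move=> k; rewrite /sub inE; case: eqP => [->|] //=.
  by case: (xab k) => [->|-> _]; rewrite ?tnth_mktuple.
rewrite -holds_tnth -(holds_ext _ subE); apply: Cb.
  apply/eqP => T0; apply: xa; apply: eq_from_tnth => k; rewrite -subE T0.
  exact: sub0.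
apply/eqP => T01; apply: xflip; apply: eq_from_tnth => k; rewrite -subE T01.
by rewrite tnth_mktuple lt2 /sub !inE tnth_mktuple.
Qed.
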